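(* Let $(b,\theta,q,m)$ be a magnetic graph over $X$ and let $p\in[1,\infty)$. Let $J$ be a set, $a,k\ge0$, $C>c>0$, and $M>0$. Suppose $(b_j,\theta,q_j,m_j)_{j\in J}$ is a family of $(a,k)_p$-magnetic-sparse magnetic graphs over $X$ such that for all $x,y\in X$, (a) $c\cdot b(x,y)\le\sum_{j\in J}b_j(x,y)\le C\cdot b(x,y)$, (b) $\sum_{j\in J}q_{j,+}(x)m_j(x)\le C\cdot q_+(x)m(x)$, (c) $\sum_{j\in J}m_j(x)\le M\cdot m(x)$. Then $(b,\theta,q,m)$ is $(aC/c+C/c-1,\,Mk/c)_p$-magnetic-sparse. Moreover, if $k=0$, then (a) and (b) are sufficient to conclude $(aC/c+C/c-1,0)_p$-magnetic-sparseness of $(b,\theta,q,m)$.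
   Context: Let $X$ be a discrete set. A magnetic graph $(b,\theta,q,m)$ over $X$ consists of: a symmetric function $b:X\times X\to[0,\infty)$ with zero diagonal and $\sum_{y\in X}b(x,y)<\infty$ for all $x\in X$; an antisymmetric function $\theta:X\times X\to\mathbb{R}/2\pi\mathbb{Z}$; a function $q:X\to\mathbb{R}$, with $q_+=q\vee0$ (and $q_{j,+}=q_j\vee 0$); and a function $m:X\to(0,\infty)$. For $p\in[1,\infty)$, finite $W\subseteq X$ and $\mathbb{T}=\{z\in\mathbb{C}:|z|=1\}$, the frustration index of $W$ in $(b,\theta,q,m)$ is $$\iota_{p,\theta}(W)=\min_{\tau:W\to\mathbb{T}}\frac12\sum_{x,y\in W}b(x,y)|\tau(x)-e^{i\theta(x,y)}\tau(y)|^p.$$ A non-negative function $g$ on a discrete set is extended to subsets by $g(A)=\sum_{x\in A}g(x)$; $\partial W=(W\times(X\setminus W))\cup((X\setminus W)\times W)$. For $a,k\ge0$, the magnetic graph $(b,\theta,q,m)$ is $(a,k)_p$-magnetic-sparse if for all finite $W\subseteq X$ $$b(W\times W)\le(1+a)\iota_{p,\theta}(W)+a\Big(\tfrac12b(\partial W)+(q_+m)(W)\Big)+k\,m(W).$$ *)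

(* Defs.v *)
From HB Require Import structures.
From mathcomp Require Import all_boot all_order all_algebra.
From mathcomp Require Import finmap.
From mathcomp Require Import generic_quotient ring_quotient.
From mathcomp Require Import all_classical all_reals all_analysis.
From mathcomp Require Import complex.
From mathcomp Require Import ring lra.
Set Implicit Arguments.
Unset Strict Implicit.
Unset Printing Implicit Defensive.
Import Order.TTheory GRing.Theory Num.Theory.
Import numFieldNormedType.Exports.
Local Open Scope classical_set_scope.
Local Open Scope ring_scope.
Local Open Scope quotient_scope.
Local Open Scope complex_scope.

Definition twopiZ (R : realType) : {pred R} :=
  fun r => `[< exists k : int, r = (pi *+ 2) *~ k >].

Lemma twopiZ_zmod_closed (R : realType) : zmod_closed (@twopiZ R).
Proof.
split=> [|_ _ /asboolP[k ->] /asboolP[l ->]]; apply/asboolP.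
  by exists 0; rewrite mulr0z.
by exists (k - l); rewrite mulrzBr.
Qed.

HB.instance Definition _ (R : realType) :=
  GRing.isZmodClosed.Build R (@twopiZ R) (@twopiZ_zmod_closed R).

Definition angle (R : realType) : zmodType := Quotient.quot (@twopiZ R).

Definition to_angle (R : realType) (r : R) : angle R :=
  \pi_(Quotient.quot (@twopiZ R)) r.

(* e^{i t}, computed on a representative of t; see expiE *)
Definition expi (R : realType) (t : angle R) : R[i] :=
  let r := repr (t : Quotient.quot (@twopiZ R)) in cos r +i* sin r.

Lemma expiE (R : realType) (r : R) : expi (to_angle r) = cos r +i* sin r.
Proof.
rewrite /expi/=; set s := repr _.
have : s == r %[mod Quotient.quot (@twopiZ R)] by rewrite /s reprK.
rewrite -Quotient.idealrBE => /asboolP[k]/eqP.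
rewrite subr_eq => /eqP ->; rewrite addrC; case: k => k.
  rewrite -pmulrn (periodicn (@cosD2pi R)).
  by rewrite (periodicn (@sinD2pi R)).
rewrite NegzE mulrNz -pmulrn; set t := r - _.
have -> : r = t + (pi *+ 2) *+ k.+1 by rewrite /t subrK.
by rewrite (periodicn (@cosD2pi R)) (periodicn (@sinD2pi R)).
Qed.

Definition circle (R : realType) : set R[i] := [set z | `|z| = 1].

Record magnetic_graph (R : realType) (X : choiceType) (b : X -> X -> R)
    (theta : X -> X -> angle R) (q m : X -> R) : Prop := MagneticGraph {
  mg_weight_ge0 : forall x y, 0 <= b x y ;
  mg_weight_sym : forall x y, b x y = b y x ;
  mg_weight_diag : forall x, b x x = 0 ;
  mg_weight_summable : forall x, (\esum_(y in [set: X]) (b x y)%:E < +oo)%E ;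
  mg_phase_antisym : forall x y, theta x y = - theta y x ;
  mg_measure_gt0 : forall x, 0 < m x }.

Definition pos_part (R : realType) (X : Type) (q : X -> R) (x : X) : R :=
  Num.max (q x) 0.

Section Frustration.
Variables (R : realType) (X : choiceType).
Variables (p : R) (b : X -> X -> R) (theta : X -> X -> angle R) (W : {fset X}).

(* normc is the R-valued modulus; the norm of R[i] itself is R[i]-valued. *)
Definition frustration_energy (tau : W -> R[i]) : R :=
  2^-1 * \sum_(x : W) \sum_(y : W) b (val x) (val y) *
    Normc.normc (tau x - expi (theta (val x) (val y)) * tau y) `^ p.

Definition frustration_values : set R :=
  [set frustration_energy tau | tau in [set tau | forall x, circle (tau x)]].

(* The infimum is a minimum: see frustration_index_min. *)
Definition frustration_index : R := inf frustration_values.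

End Frustration.

Lemma powR_norm_continuous (R : realType) (p : R) :
  0 < p -> continuous (fun x : R => `|x| `^ p).
Proof.
move=> p0 x; have [->|x0] := eqVneq x 0.
  apply/cvgrPdist_lt => e e0; rewrite normr0 powR0 ?gt_eqF//.
  near=> t; rewrite sub0r normrN ger0_norm ?powR_ge0//.
  have -> : e = (e `^ p^-1) `^ p by rewrite -powRrM mulVf ?gt_eqF// powRr1 ?ltW.
  rewrite gt0_ltr_powR ?nnegrE ?powR_ge0//.
  near: t; apply: (cvgr0_norm_lt (fun t : R => t)); last exact: powR_gt0.
  exact: cvg_id.
suff : {for x, continuous ((@powR R ^~ p) \o (fun x : R => `|x|))} by [].
apply: continuous_comp; first exact: norm_continuous.
apply/differentiable_continuous/derivable1_diffP/derivable_powR.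
by rewrite in_itv/= andbT normr_gt0.
Unshelve. all: by end_near. Qed.

Lemma circleP (R : realType) (z : R[i]) :
  circle z -> exists2 t, t \in `[- pi, pi : R] & z = cos t +i* sin t.
Proof.
case: z => x y; rewrite /circle/= normc_def => -[s1].
have xy : x ^+ 2 + y ^+ 2 = 1.
  by rewrite -[LHS]sqr_sqrtr ?addr_ge0 ?sqr_ge0// s1 expr1n.
have x1 : -1 <= x <= 1 by apply/andP; split; nra.
have yE : Num.sqrt (1 - x ^+ 2) = `|y|.
  by rewrite -xy/= addrAC subrr add0r sqrtr_sqr.
have [y0|y0] := leP 0 y.
  exists (acos x); last by rewrite acosK ?in_itv// sin_acos// yE ger0_norm.
  by rewrite in_itv/= acos_lepi// (le_trans _ (acos_ge0 _))// oppr_le0 pi_ge0.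
exists (- acos x); last first.
  by rewrite cosN sinN acosK ?in_itv// sin_acos// yE ltr0_norm// opprK.
rewrite in_itv/= lerN2 acos_lepi//= (@le_trans _ _ 0) ?pi_ge0//.
by rewrite oppr_le0 acos_ge0.
Qed.

Lemma circle_expi (R : realType) (t : R) : circle (cos t +i* sin t).
Proof. by rewrite /circle/= normc_def/= cos2Dsin2 sqrtr1. Qed.

Lemma frustration_index_min (R : realType) (X : choiceType) (p : R)
    (b : X -> X -> R) (theta : X -> X -> angle R) (W : {fset X}) : 1 <= p ->
  (exists2 tau : W -> R[i], (forall x, circle (tau x)) &
     frustration_energy p b theta tau = frustration_index p b theta W) /\
  (forall tau : W -> R[i], (forall x, circle (tau x)) ->
     frustration_index p b theta W <= frustration_energy p b theta tau).
Proof.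
move=> p1; have p0 : 0 < p by apply: lt_le_trans p1.
pose tau_ (v : 'rV[R]_#|{: W}|) (x : W) : R[i] :=
  cos (v ord0 (enum_rank x)) +i* sin (v ord0 (enum_rank x)).
pose A := [set v : 'rV[R]_#|{: W}| | forall i, `[- pi, pi : R]%classic (v ord0 i)].
pose F v := frustration_energy p b theta (tau_ v).
have cA : compact A.
  have cI (i : 'I_#|{: W}|) : compact `[- pi, pi : R] by exact: segment_compact.
  have H := @rV_compact R #|{: W}| _ cI.
  exact H.
have A0 : A !=set0.
  exists 0 => i /=; rewrite mxE in_itv/= oppr_le0 pi_ge0//=.
have cF : continuous F.
  suff cS : continuous (fun v : 'rV[R]_#|{: W}| => \sum_(x : W) \sum_(y : W)
      b (val x) (val y) * Normc.normc
        (tau_ v x - expi (theta (val x) (val y)) * tau_ v y) `^ p).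
    by move=> v; exact: (cvgM (cvg_cst _) (cS v)).
  have cadd : continuous (fun z : R * R => z.1 + z.2).
    by move=> z; apply: cvgD; [exact: cvg_fst|exact: cvg_snd].
  apply: (continuous_big cadd) => x _; apply: (continuous_big cadd) => y _.
  suff cN : continuous (fun v : 'rV[R]_#|{: W}| => Normc.normc
        (tau_ v x - expi (theta (val x) (val y)) * tau_ v y) `^ p).
    by move=> v; exact: (cvgM (cvg_cst _) (cN v)).
  set r : R := repr (theta (val x) (val y) : Quotient.quot (@twopiZ R)).
  pose c i (v : 'rV[R]_#|{: W}|) : R := cos (v ord0 i).
  pose s i (v : 'rV[R]_#|{: W}|) : R := sin (v ord0 i).
  have cc i : continuous (c i).
    move=> v; apply: (continuous_comp (g := @cos R)); last exact: continuous_cos.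
    exact: coord_continuous.
  have cs i : continuous (s i).
    move=> v; apply: (continuous_comp (g := @sin R)); last exact: continuous_sin.
    exact: coord_continuous.
  have ck (k : R) f : continuous f ->
      continuous (fun v : 'rV[R]_#|{: W}| => k * f v).
    by move=> cf v; exact: (cvgM (cvg_cst _) (cf v)).
  pose i := enum_rank x; pose j := enum_rank y.
  pose P v := c i v - (cos r * c j v - sin r * s j v).
  pose Q v := s i v - (cos r * s j v + sin r * c j v).
  have cP : continuous P.
    move=> v; apply: (cvgB (cc i v)).
    exact: (cvgB (ck _ _ (cc j) v) (ck _ _ (cs j) v)).
  have cQ : continuous Q.
    move=> v; apply: (cvgB (cs i v)).
    exact: (cvgD (ck _ _ (cs j) v) (ck _ _ (cc j) v)).
  have cPQ : continuous (fun v => P v * P v + Q v * Q v).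
    by move=> v; exact: (cvgD (cvgM (cP v) (cP v)) (cvgM (cQ v) (cQ v))).
  have cG : continuous (Num.sqrt \o (fun v => P v * P v + Q v * Q v)).
    by move=> v; apply: continuous_comp; [exact: cPQ|exact: sqrt_continuous].
  rewrite (_ : (fun _ => _) = (fun t => `|t| `^ p) \o
      (Num.sqrt \o (fun v => P v * P v + Q v * Q v))); last first.
    by apply/funext => v /=; rewrite ger0_norm ?sqrtr_ge0// -!expr2.
  by move=> v; apply: continuous_comp;
    [exact: cG|exact: powR_norm_continuous].
have [v /set_mem Av vmin] :=
  EVT_min_rV A0 cA (continuous_subspaceT cF).
have tmin (tau : W -> R[i]) : (forall x, circle (tau x)) ->
    F v <= frustration_energy p b theta tau.
  move=> tc; have /(_ _)/cid2 t_ := circleP (tc _).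
  pose w : 'rV[R]_#|{: W}| := \row_i s2val (t_ (enum_val i)).
  have -> : tau = tau_ w.
    apply/funext => x; rewrite /tau_ mxE enum_rankK.
    by case: (t_ x).
  apply: vmin; rewrite inE => i /=; rewrite mxE.
  by case: (t_ _).
have tv x : circle (tau_ v x) by exact: circle_expi.
suff E : frustration_index p b theta W = F v.
  by rewrite E; split => //; exists (tau_ v).
apply/eqP; rewrite eq_le; apply/andP; split.
  apply: ge_inf; last by exists (tau_ v).
  by exists (F v) => _ [tau tc <-]; exact: tmin.
apply: lb_le_inf; first by exists (F v); exists (tau_ v).
by move=> _ [tau tc <-]; exact: tmin.
Qed.

(* The extension of a non-negative function to subsets; it is +oo-valued when
   the sum diverges. *)
Definition sum_on (R : realType) (T : choiceType) (g : T -> R) (A : set T) :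
  \bar R := \esum_(x in A) (g x)%:E.

Definition boundary (X : Type) (W : set X) : set (X * X) :=
  (W `*` ~` W) `|` (~` W `*` W).

Definition magnetic_sparse (R : realType) (X : choiceType) (p a k : R)
    (b : X -> X -> R) (theta : X -> X -> angle R) (q m : X -> R) : Prop :=
  forall W : {fset X},
  let W' := [set` W] in
  let b2 z := b z.1 z.2 in
  (sum_on b2 (W' `*` W') <=
     ((1 + a) * frustration_index p b theta W)%:E
     + a%:E * (2^-1%:E * sum_on b2 (boundary W')
               + sum_on (fun x => pos_part q x * m x)%R W')
     + k%:E * sum_on m W')%E.

(* Main.v *)
Require Import Defs.
From HB Require Import structures.
From mathcomp Require Import all_boot all_order all_algebra.
From mathcomp Require Import finmap.
From mathcomp Require Import all_classical all_reals all_analysis.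
From mathcomp Require Import complex.
From mathcomp Require Import ring lra.
Import Order.TTheory GRing.Theory Num.Theory.
Local Open Scope classical_set_scope.
Local Open Scope ring_scope.

Set Implicit Arguments.
Unset Strict Implicit.

(** The proof sums the sparseness inequalities of the graphs [b_ j] over [j] at
    a fixed finite [W].  On the left, exchanging sums gives at least
    [c b(W x W)].  On the right, the boundary, potential and measure terms are
    again exchanged sums, bounded with the constants [C], [C] and [M] or,
    when [k = 0], vanishing.  The one term that is not a sum is the
    frustration index: a minimizer [tau] for [b] is only a competitor for every
    [b_ j], so the sum of the indices is at most the sum of the energies of
    [tau], and the energy is linear in the weight: the total is at most [C]
    times the index of [b] ([esum_frustration_index_le]).  Hence

      [c b(W x W) <= (1 + a) C iota(W) + a C (b(dW) / 2 + (q_+ m)(W)) + M k m(W)].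

    Dividing by [c], the coefficient of [iota(W)] is [(1 + a) C / c], which
    forces [a' = (1 + a) C / c - 1] as the new first parameter; the coefficient
    [a C / c] in front of the boundary and potential is at most [a'] because
    [C / c >= 1].  The sums over [J] and over the boundary have infinitely many
    terms, so the argument runs over the extended non-negative reals, where
    exchanging sums and pulling out non-negative constants are unconditional. *)

(** One inequality, applied to both [r] and [r^-1], gives the other. *)
Lemma esumZl (R : realType) (T : choiceType) (S : set T) (r : R)
    (f : T -> \bar R) :
  0 <= r -> (forall i, (0 <= f i)%E) ->
  (\esum_(i in S) (r%:E * f i) = r%:E * \esum_(i in S) f i)%E.
Proof.
have le_esumZ (s : R) (g : T -> \bar R) : 0 <= s -> (forall i, (0 <= g i)%E) ->
    (\esum_(i in S) (s%:E * g i) <= s%:E * \esum_(i in S) g i)%E.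
  move=> s0 g0; apply: ge_ereal_sup => _ [X [finX XS] <-].
  by rewrite -ge0_mule_fsumr// lee_wpmul2l ?lee_fin// esum_ge//; exists X.
rewrite le_eqVlt => /predU1P[<- f0|r0 f0].
  by rewrite mul0e esum1// => i _; rewrite mul0e.
apply/eqP; rewrite eq_le le_esumZ ?(ltW r0)//= -lee_pdivlMl//.
have rf0 i : (0 <= r%:E * f i)%E by rewrite mule_ge0// lee_fin ltW.
apply: le_trans (le_esumZ _ _ _ rf0); last by rewrite invr_ge0 ltW.
by apply: le_esum => i _; rewrite muleA -EFinM mulVf ?gt_eqF// mul1e.
Qed.

Lemma exchange_esum (R : realType) (T1 T2 : choiceType) (A : set T1)
    (B : set T2) (f : T1 -> T2 -> \bar R) :
  (forall i j, (0 <= f i j)%E) ->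
  (\esum_(i in A) \esum_(j in B) f i j = \esum_(j in B) \esum_(i in A) f i j)%E.
Proof.
move=> f0; rewrite !esum_esum//.
apply: (reindex_esum _ _ (fun z : T2 * T1 => (z.2, z.1))); split.
- by move=> [j i] /= [].
- by move=> [j i] [j' i'] _ _ /= [-> ->].
- by move=> [i j] /= [Ai Bj]; exists (j, i).
Qed.

Lemma esum_sum_on_le (R : realType) (J T : choiceType)
    (g_ : J -> T -> R) (g : T -> R) (K : R) (A : set T) :
  0 <= K -> (forall j x, 0 <= g_ j x) -> (forall x, 0 <= g x) ->
  (forall x, (\esum_(j in [set: J]) (g_ j x)%:E <= (K * g x)%:E)%E) ->
  (\esum_(j in [set: J]) sum_on (g_ j) A <= K%:E * sum_on g A)%E.
Proof.
move=> K0 g_0 g0 gK; rewrite /sum_on exchange_esum -?esumZl//.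
by apply: le_esum => x _; rewrite -EFinM.
Qed.

Lemma esum_sum_on_ge (R : realType) (J T : choiceType)
    (g_ : J -> T -> R) (g : T -> R) (K : R) (A : set T) :
  0 <= K -> (forall j x, 0 <= g_ j x) -> (forall x, 0 <= g x) ->
  (forall x, ((K * g x)%:E <= \esum_(j in [set: J]) (g_ j x)%:E)%E) ->
  (K%:E * sum_on g A <= \esum_(j in [set: J]) sum_on (g_ j) A)%E.
Proof.
move=> K0 g_0 g0 gK; rewrite /sum_on exchange_esum -?esumZl//.
by apply: le_esum => x _; rewrite -EFinM.
Qed.

Lemma frustration_energy_ge0 (R : realType) (X : choiceType) (p : R)
    (b : X -> X -> R) (theta : X -> X -> angle R) (W : {fset X}) (tau : W -> R[i]) :
  (forall x y, 0 <= b x y) -> 0 <= frustration_energy p b theta tau.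
Proof.
move=> b0; rewrite mulr_ge0 ?invr_ge0//.
by do 2!(apply: sumr_ge0 => ? _); rewrite mulr_ge0 ?powR_ge0.
Qed.

Lemma frustration_index_ge0 (R : realType) (X : choiceType) (p : R)
    (b : X -> X -> R) (theta : X -> X -> angle R) (W : {fset X}) :
  1 <= p -> (forall x y, 0 <= b x y) -> 0 <= frustration_index p b theta W.
Proof.
move=> p1 b0; have [[tau _ <-] _] := frustration_index_min b theta W p1.
exact: frustration_energy_ge0.
Qed.

(** For fixed [tau] the energy is a non-negative linear form in the edge
    weight, so a pointwise bound on the weights carries over. *)
Lemma esum_frustration_energy_le (R : realType) (J X : choiceType) (p C : R)
    (b_ : J -> X -> X -> R) (b : X -> X -> R) (theta : X -> X -> angle R)
    (W : {fset X}) (tau : W -> R[i]) :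
  (forall j x y, 0 <= b_ j x y) ->
  (forall x y, (\esum_(j in [set: J]) (b_ j x y)%:E <= (C * b x y)%:E)%E) ->
  (\esum_(j in [set: J]) (frustration_energy p (b_ j) theta tau)%:E
     <= (C * frustration_energy p b theta tau)%:E)%E.
Proof.
move=> b_0 bC; rewrite /frustration_energy mulrCA EFinM.
under eq_esum do rewrite EFinM -sumEFin.
pose w (x y : W) := Normc.normc
  (tau x - expi (theta (val x) (val y)) * tau y) `^ p.
have w0 x y : 0 <= w x y by exact: powR_ge0.
rewrite esumZl ?invr_ge0//; last first.
  move=> j; apply: sume_ge0 => x _; rewrite lee_fin.
  by apply: sumr_ge0 => y _; rewrite mulr_ge0// w0.
rewrite lee_wpmul2l ?lee_fin ?invr_ge0//.
rewrite esum_sum; last first.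
  move=> j x _ _; rewrite lee_fin.
  by apply: sumr_ge0 => y _; rewrite mulr_ge0// w0.
rewrite mulr_sumr -sumEFin; apply: lee_sum => x _.
under eq_esum do rewrite -sumEFin.
rewrite esum_sum; last by move=> j y _ _; rewrite lee_fin mulr_ge0// w0.
rewrite mulr_sumr -sumEFin; apply: lee_sum => y _.
under eq_esum do rewrite mulrC EFinM.
rewrite esumZl ?w0//; last by move=> j; rewrite lee_fin.
by rewrite mulrA [X in (_ <= X%:E)%E]mulrC EFinM lee_wpmul2l ?lee_fin ?w0.
Qed.

(** The minimizer for [b] is a competitor in the minimization for each [b_ j];
    this uses that all the graphs share the phase [theta]. *)
Lemma esum_frustration_index_le (R : realType) (J X : choiceType) (p C : R)
    (b_ : J -> X -> X -> R) (b : X -> X -> R) (theta : X -> X -> angle R)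
    (W : {fset X}) :
  1 <= p -> (forall j x y, 0 <= b_ j x y) ->
  (forall x y, (\esum_(j in [set: J]) (b_ j x y)%:E <= (C * b x y)%:E)%E) ->
  (\esum_(j in [set: J]) (frustration_index p (b_ j) theta W)%:E
     <= (C * frustration_index p b theta W)%:E)%E.
Proof.
move=> p1 b_0 bC.
have [[tau tauC <-] _] := frustration_index_min b theta W p1.
apply: le_trans (esum_frustration_energy_le p theta tau b_0 bC).
apply: le_esum => j _; rewrite lee_fin.
by have [_ ->] := frustration_index_min (b_ j) theta W p1.
Qed.

(** Bounding [k * m_ j] instead of [m_ j] covers both conclusions of the
    theorem: [K = k * M] when the [m_ j] sum to at most [M * m], and
    [K = 0] when [k = 0], where the family [m_] may well not be summable. *)
Lemma magnetic_sparse_family (R : realType) (J X : choiceType) (p : R)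
    (b : X -> X -> R) (theta : X -> X -> angle R) (q m : X -> R)
    (a k K c C : R)
    (b_ : J -> X -> X -> R) (q_ m_ : J -> X -> R) :
  1 <= p ->
  magnetic_graph b theta q m ->
  0 <= a -> 0 <= k -> 0 <= K -> 0 < c -> c <= C ->
  (forall j, magnetic_graph (b_ j) theta (q_ j) (m_ j)) ->
  (forall j, magnetic_sparse p a k (b_ j) theta (q_ j) (m_ j)) ->
  (forall x y, ((c * b x y)%:E <= \esum_(j in [set: J]) (b_ j x y)%:E
                               <= (C * b x y)%:E)%E) ->
  (forall x, (\esum_(j in [set: J]) (pos_part (q_ j) x * m_ j x)%:E
                               <= (C * (pos_part q x * m x))%:E)%E) ->
  (forall x, (\esum_(j in [set: J]) (k * m_ j x)%:E <= (K * m x)%:E)%E) ->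
  magnetic_sparse p (a * C / c + C / c - 1) (K / c) b theta q m.
Proof.
move=> p1 G a0 k0 K0 c0 cC G_ S_ bcC qC mK W; cbv zeta.
set W' := [set` W]; set b2 := (fun z : X * X => b z.1 z.2).
have C0 : 0 <= C by exact: le_trans (ltW c0) cC.
have b0 := mg_weight_ge0 G; have b_0 j := mg_weight_ge0 (G_ j).
have m0 x := ltW (mg_measure_gt0 G x).
have m_0 j x := ltW (mg_measure_gt0 (G_ j) x).
have qm0 x : 0 <= pos_part q x * m x by rewrite mulr_ge0// le_max lexx orbT.
have qm_0 j x : 0 <= pos_part (q_ j) x * m_ j x.
  by rewrite mulr_ge0// le_max lexx orbT.
pose I := frustration_index p b theta W.
pose b2_ j (z : X * X) := b_ j z.1 z.2.
have sum0 (T : choiceType) (g : T -> R) A : (forall x, 0 <= g x) ->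
    (0 <= sum_on g A)%E by move=> g0; apply: esum_ge0 => x _; rewrite lee_fin.
have bd0 : (0 <= sum_on b2 (boundary W'))%E by apply: sum0 => z; exact: b0.
have bd_0 j : (0 <= sum_on (b2_ j) (boundary W'))%E.
  by apply: sum0 => z; exact: b_0.
have Q0 := sum0 _ _ W' qm0; have Q_0 j := sum0 _ _ W' (qm_0 j).
have M0 := sum0 _ _ W' m0; have M_0 j := sum0 _ _ W' (m_0 j).
have I_0 j : 0 <= frustration_index p (b_ j) theta W.
  exact: frustration_index_ge0 theta W p1 (b_0 j).
have half0 : (0 <= 2^-1%:E :> \bar R)%E by rewrite lee_fin invr_ge0.
have km j : (k%:E * sum_on (m_ j) W' = sum_on (fun x => k * m_ j x)%R W')%E.
  by rewrite /sum_on -esumZl// => x; rewrite lee_fin.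
have key : (c%:E * sum_on b2 (W' `*` W') <=
    ((1 + a) * (C * I))%:E
    + a%:E * (2^-1%:E * (C%:E * sum_on b2 (boundary W'))
              + C%:E * sum_on (fun x => pos_part q x * m x)%R W')
    + K%:E * sum_on m W')%E.
  apply: (@le_trans _ _ (\esum_(j in [set: J]) sum_on (b2_ j) (W' `*` W'))%E).
    apply: esum_sum_on_ge => [|j z|z|z]; [exact: ltW|exact: b_0|exact: b0|].
    by have /andP[] := bcC z.1 z.2.
  apply: le_trans (le_esum (fun j _ => S_ j W)) _.
  have R0 j : (0 <= 2^-1%:E * sum_on (b2_ j) (boundary W')
      + sum_on (fun x => pos_part (q_ j) x * m_ j x)%R W')%E.
    by rewrite adde_ge0// mule_ge0.
  rewrite esumD; first last.
  - by move=> j _; rewrite mule_ge0.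
  - move=> j _; rewrite adde_ge0 ?mule_ge0 ?R0//.
    by rewrite lee_fin mulr_ge0 ?addr_ge0.
  rewrite esumD; first last.
  - by move=> j _; rewrite mule_ge0 ?R0.
  - by move=> j _; rewrite lee_fin mulr_ge0 ?addr_ge0.
  apply: leeD; first apply: leeD.
  - under eq_esum do rewrite EFinM.
    rewrite esumZl ?addr_ge0// EFinM lee_wpmul2l ?lee_fin ?addr_ge0//.
    apply: esum_frustration_index_le => // x y.
    by have /andP[] := bcC x y.
  - rewrite esumZl// lee_wpmul2l// esumD; first last.
    + by move=> j _.
    + by move=> j _; apply: mule_ge0 (bd_0 j).
    rewrite esumZl ?invr_ge0//; apply: leeD.
    + rewrite lee_wpmul2l//; apply: esum_sum_on_le => // z.
      * exact: b0.
      * by have /andP[] := bcC z.1 z.2.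
    + exact: esum_sum_on_le.
  - under eq_esum do rewrite km.
    by apply: esum_sum_on_le => // j x; rewrite mulr_ge0.
move: key; rewrite -lee_pdivlMl// => /le_trans; apply.
have c'0 : (0 <= c^-1%:E)%E by rewrite lee_fin invr_ge0 ltW.
have I0 : 0 <= I by exact: frustration_index_ge0 theta W p1 b0.
set T := (2^-1%:E * sum_on b2 (boundary W') + _)%E.
have T0 : (0 <= T)%E by rewrite adde_ge0// mule_ge0.
rewrite muleCA -ge0_muleDr ?mule_ge0// -/T.
have aCT0 : (0 <= a%:E * (C%:E * T))%E by rewrite !mule_ge0.
have aCI0 : (0 <= ((1 + a) * (C * I))%:E)%E.
  by rewrite lee_fin !mulr_ge0 ?addr_ge0.
rewrite ge0_muleDr ?(adde_ge0 aCI0 aCT0) ?mule_ge0// ge0_muleDr//.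
apply: leeD; first apply: leeD.
- rewrite -EFinM lee_fin -/I le_eqVlt; apply/orP; left; apply/eqP; field.
  by rewrite gt_eqF.
- rewrite !muleA -!EFinM lee_wpmul2r// lee_fin.
  have : 1 <= C / c by rewrite ler_pdivlMr ?mul1r.
  by lra.
- by rewrite muleA -EFinM mulrC.
Qed.

Unset Implicit Arguments.
Set Strict Implicit.

Theorem proposition4p10 (R : realType) (X J : choiceType) (p : R)
    (b : X -> X -> R) (theta : X -> X -> angle R) (q m : X -> R)
    (a k c C : R)
    (b_ : J -> X -> X -> R) (q_ m_ : J -> X -> R) :
  1 <= p ->
  magnetic_graph b theta q m ->
  0 <= a -> 0 <= k -> 0 < c -> c < C ->
  (forall j, magnetic_graph (b_ j) theta (q_ j) (m_ j)) ->
  (forall j, magnetic_sparse p a k (b_ j) theta (q_ j) (m_ j)) ->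
  (forall x y, ((c * b x y)%:E <= \esum_(j in [set: J]) (b_ j x y)%:E
                               <= (C * b x y)%:E)%E) ->
  (forall x, (\esum_(j in [set: J]) (pos_part (q_ j) x * m_ j x)%:E
                               <= (C * (pos_part q x * m x))%:E)%E) ->
  (forall M : R, 0 < M ->
     (forall x, (\esum_(j in [set: J]) (m_ j x)%:E <= (M * m x)%:E)%E) ->
     magnetic_sparse p (a * C / c + C / c - 1) (M * k / c) b theta q m)
  /\
  (k = 0 -> magnetic_sparse p (a * C / c + C / c - 1) 0 b theta q m).
Proof.
move=> p1 G a0 k0 c0 cC G_ S_ bcC qC; split=> [M M0 mM|k_eq0].
  have m_0 j x : 0 <= m_ j x := ltW (mg_measure_gt0 (G_ j) x).
  rewrite (mulrC M); apply: magnetic_sparse_family (ltW cC) G_ S_ bcC qC _ => //.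
    by rewrite mulr_ge0// ltW.
  move=> x; under eq_esum do rewrite EFinM.
  rewrite esumZl//; last by move=> j; rewrite lee_fin.
  by rewrite -mulrA EFinM lee_wpmul2l.
rewrite -[X in magnetic_sparse _ _ X](mul0r c^-1).
apply: magnetic_sparse_family (ltW cC) G_ S_ bcC qC _ => // x.
by rewrite mul0r esum1// => j _; rewrite k_eq0 mul0r.
Qed.
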